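(* Let $f$ be a maximal coupling function for the kernel $p$ on the alphabet $G$, assume $a_1>0$ and $a_k\uparrow1$, let $\mathbf{U}=\{U_i\}_{i\in\mathbf{Z}}$ be i.i.d. uniform on $[0,1)$, and define $$\tau_0=\sup\Big\{m<0:\exists\, l\in[m,0]\ \text{such that}\ \big(U_l/a_1,\dots,U_m/a_1\big)\in E_{l-m+1}\ \text{and, if } l<0,\ K(U_j)\le j-l\ \text{for all } j\in[l+1,0]\Big\}.$$ Suppose (i) $\sum_{n=1}^\infty\prod_{m=1}^n a_m=\infty$; (ii) there exists $s\in\mathbf{N}^*$ such that $P\big((U_{s-1},\dots,U_0)\in E_s\big)>0$. Then $\tau_0$ is finite almost surely.
   Context: $G$ finite or countable; histories $\mathbf{w}=(w_{-1},w_{-2},\dots)\in G^{-\mathbf{N}^*}$; kernel $p(g|\mathbf{w})$ measurable in $\mathbf{w}$, summing to 1 over $g$. Admissible histories $\mathcal{H}$: a letter $g$ is forbidden if $p(g|\mathbf{w})=0$ for all $\mathbf{w}$; a word $(s_0,\dots,s_{-n})$ is forbidden if $(s_{-1},\dots,s_{-n})$ is forbidden or $p(s_0|\mathbf{w})=0$ for all histories beginning with $(s_{-1},\dots,s_{-n})$; $\mathbf{w}\in\mathcal{H}$ iff no initial word is forbidden. $a_0(g)=\inf\{p(g|\mathbf{z}):\mathbf{z}\in\mathcal{H}\}$; for $k\ge1$, $a_k(g|w_{-1},\dots,w_{-k})=\inf\{p(g|\mathbf{z}):\mathbf{z}\in\mathcal{H},(z_{-1},\dots,z_{-k})=(w_{-1},\dots,w_{-k})\}$;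 $b_k=a_k-a_{k-1}$ ($a_{-1}\equiv0$); $a_k(w_{-1},\dots,w_{-k})=\sum_ga_k(g|\cdot)$; $a_0=\sum_ga_0(g)$; $a_k=\inf_{\mathbf{w}\in\mathcal{H}}a_k(w_{-1},\dots,w_{-k})$. Maximal coupling function $f:[0,1)\times\mathcal{H}\to G$: $[a_{k-1}(w_{-1},\dots,w_{-k+1}),a_k(w_{-1},\dots,w_{-k}))$ is partitioned into intervals $B_k(g|w_{-1},\dots,w_{-k})$ of length $b_k(g|\cdot)$, $g\in G$, and $f(u|\mathbf{w})=g$ on $\bigcup_kB_k(g|\cdot)$. Markovian coupling: $\tilde f(u|w)=f(a_1u|\mathbf{w})$ for $u\in[0,1)$, $w\in G$, any $\mathbf{w}\in\mathcal{H}$ with $w_{-1}=w$; $\tilde f^{(1)}=\tilde f$, $\tilde f^{(n)}(u_n,\dots,u_1|w)=\tilde f(u_n|\tilde f^{(n-1)}(u_{n-1},\dots,u_1|w))$. For fixed $g_0\in G$, $E_n=\{(u_0,u_{-1},\dots,u_{-n+1})\in[0,1)^n:\tilde f^{(n)}(u_0,\dots,u_{-n+1}|w)=\tilde f^{(n)}(u_0,\dots,u_{-n+1}|g_0)\ \forall w\in G\}$; in (ii), $(U_{s-1},\dots,U_0)$ is the point $(u_0,\dots,u_{-s+1})=(U_{s-1},\dots,U_0)$. $K(u)=\inf\{k\in\mathbf{N}:a_k>u\}$. *)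

(* Defs.v *)
From HB Require Import structures.
From mathcomp Require Import all_boot all_order all_algebra.
From mathcomp Require Import all_classical all_reals all_analysis.
From Stdlib Require Import ClassicalEpsilon.

Set Implicit Arguments.
Unset Strict Implicit.
Unset Printing Implicit Defensive.

Import Order.TTheory GRing.Theory Num.Theory.
Import numFieldNormedType.Exports.
Local Open Scope classical_set_scope.
Local Open Scope ring_scope.

(* Histories w = (w_{-1}, w_{-2}, ...) are encoded as  w : nat -> G
   with  w i = w_{-(i+1)}.  Finite words (s_{-1},...,s_{-n}) are encoded as
   the list [:: s_{-1}; ...; s_{-n}] : seq G, so the initial word of length
   n of a history w is  mkseq w n. *)

Definition Ico {R : realType} (a b : R) : set R := [set x | a <= x < b].

Section Kernel.
Context {R : realType} {G : countType} (p : G -> (nat -> G) -> R).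

(* cylinder sets {w | (w_{-1},...,w_{-n}) = s}; they generate the product
   sigma-algebra on G^{-N*} (G countable, discrete). *)
Definition cylinders : set (set (nat -> G)) :=
  [set [set w | mkseq w (size s) = s] | s in [set: seq G]].

Definition kernel_measurable : Prop :=
  forall (g : G) (B : set R), measurable B -> <<s cylinders >> (p g @^-1` B).

(* A word (s_0, s_{-1}, ..., s_{-n}) is the list [:: s_0, s_{-1}, ..., s_{-n}].
   The empty word is not forbidden; a word s0 :: rest is forbidden iff rest is
   forbidden or p(s0|z) = 0 for every history z beginning with rest.  For
   rest = [::] this is exactly "the letter s0 is forbidden". *)
Fixpoint forbidden (s : seq G) : Prop :=
  match s with
  | [::] => False
  | s0 :: rest => forbidden rest \/
      (forall z : nat -> G, mkseq z (size rest) = rest -> p s0 z = 0)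
  end.

Definition admissible (w : nat -> G) : Prop :=
  forall n : nat, ~ forbidden (mkseq w n).

Definition ak (g : G) (s : seq G) : R :=
  inf [set p g z | z in [set z | admissible z /\ mkseq z (size s) = s]].

(* a_k(g | ...) with the convention a_{-1} = 0, indexed by k *)
Definition akw (k : int) (g : G) (w : nat -> G) : R :=
  match k with
  | Posz n => ak g (mkseq w n)
  | Negz _ => 0
  end.

Definition bk (k : nat) (g : G) (w : nat -> G) : R :=
  akw k g w - akw (k%:Z - 1) g w.

Definition aword (k : int) (w : nat -> G) : R :=
  fine (\esum_(g in [set: G]) (akw k g w)%:E).

Definition A (k : nat) : R :=
  inf [set aword k w | w in admissible].

(* f : [0,1) x H -> G is a maximal coupling function: for every admissible w
   and every k, the interval [a_{k-1}(w..), a_k(w..)) is partitioned into the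
   intervals B_k(g|w_{-1..-k}) = [c k g (w_{-1..-k}), c ... + b_k(g|...)),
   g in G (depending only on the first k letters of w), and f(u|w) = g on
   the union over k of the B_k(g|...). *)
Definition max_coupling (f : R -> (nat -> G) -> G) : Prop :=
  exists c : nat -> G -> seq G -> R,
    (forall (w : nat -> G) (k : nat), admissible w ->
       (forall g g' : G, g != g' ->
          Ico (c k g (mkseq w k)) (c k g (mkseq w k) + bk k g w) `&`
          Ico (c k g' (mkseq w k)) (c k g' (mkseq w k) + bk k g' w) = set0) /\
       \bigcup_(g in [set: G]) Ico (c k g (mkseq w k)) (c k g (mkseq w k) + bk k g w)
         = Ico (aword (k%:Z - 1) w) (aword k w)) /\
    (forall (w : nat -> G) (k : nat) (g : G) (u : R), admissible w ->
       0 <= u < 1 ->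
       Ico (c k g (mkseq w k)) (c k g (mkseq w k) + bk k g w) u -> f u w = g).

Definition allowed (x : G) : Prop := exists z, admissible z /\ z 0%N = x.

Definition ftilde (f : R -> (nat -> G) -> G) (u : R) (x : G) : G :=
  f (A 1 * u) (epsilon (inhabits (fun _ : nat => x))
                       (fun z => admissible z /\ z 0%N = x)).

(* f~^(n)(u_n, ..., u_1 | x), the argument list being [:: u_n; ...; u_1]
   (u_1 is applied first) *)
Fixpoint ftilde_iter (f : R -> (nat -> G) -> G) (us : seq R) (x : G) : G :=
  match us with
  | [::] => x
  | u :: rest => ftilde f u (ftilde_iter f rest x)
  end.

(* E_n : the list [:: u_0; u_{-1}; ...; u_{-n+1}] of points of [0,1)^n such
   that f~^(n)(u_0, ..., u_{-n+1} | w) does not depend on the (allowed)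
   starting letter w. *)
Definition E (f : R -> (nat -> G) -> G) (n : nat) (us : seq R) : Prop :=
  size us = n /\ (forall u, u \in us -> 0 <= u < 1) /\
  forall w w' : G, allowed w -> allowed w' ->
    ftilde_iter f us w = ftilde_iter f us w'.

(* "K(u) <= n" where K(u) = inf {k in N : a_k > u} (inf of a set of naturals
   is <= n iff the set has an element <= n) *)
Definition K_le (u : R) (n : int) : Prop :=
  exists k : nat, (k%:Z <= n) /\ u < A k.

End Kernel.

Section Randomness.
Context {R : realType} {d : measure_display} {Omega : measurableType d}.

Definition iid_uniform01 (P : probability Omega R) (U : int -> Omega -> R) : Prop :=
  (forall i, measurable_fun setT (U i)) /\
  (forall i (B : set R), measurable B ->
     P (U i @^-1` B) = lebesgue_measure (B `&` Ico 0 1)) /\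
  (forall (S : seq int) (B : int -> set R), uniq S ->
     (forall i, measurable (B i)) ->
     P (\bigcap_(i in [set` S]) (U i @^-1` B i)) =
       (\prod_(i <- S) P (U i @^-1` B i))%E).

Definition tau0_set {G : countType} (p : G -> (nat -> G) -> R)
  (f : R -> (nat -> G) -> G) (U : int -> Omega -> R) (om : Omega) : set int :=
  [set m : int | m < 0 /\
     exists l : int, m <= l <= 0 /\
       E p f (absz (l - m)).+1
         [seq U (l - i%:Z) om / A p 1 | i <- iota 0 (absz (l - m)).+1] /\
       (l < 0 -> forall j : int, l + 1 <= j <= 0 -> K_le p (U j om) (j - l))].

(* tau_0 = sup of that set, in the extended reals (sup of the empty set = -oo) *)
Definition tau0 {G : countType} (p : G -> (nat -> G) -> R)
  (f : R -> (nat -> G) -> G) (U : int -> Omega -> R) (om : Omega) : \bar R :=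
  ereal_sup [set (m%:~R)%:E | m in tau0_set p f U om].

End Randomness.

(* Main.v *)
(** Let R_m be the event that U_{-i} < a_{m-i} for all 0 <= i < m: a coupling
    started at time -m then never looks beyond time -m.  Let G_m be R_m together
    with the event that the s rescaled variables U_{-m}/a_1, U_{-m-1}/a_1, ...
    belong to E_s; tau_0 is finite as soon as some G_m with m >= 1 occurs.
    Independence gives P(G_m) = delta a_1 ... a_m with delta > 0 by (ii), so
    these probabilities have infinite sum by (i).  If G_n is the first to occur,
    which is decided by U_0, ..., U_{-(n+s-1)}, a later G_{n+s+k} requires G_k
    for the variables shifted by n+s, which has probability P(G_k) and is
    independent of what was seen.  If S is a partial sum of the P(G_m) and q is
    the probability that some G_m occurs, then S <= q (S + s + 1), and S can be
    taken arbitrarily large, so q = 1. *)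
Require Import Defs.
From Stdlib Require ClassicalEpsilon.
From HB Require Import structures.
From mathcomp Require Import all_boot all_order all_algebra.
From mathcomp Require Import all_classical all_reals all_analysis.
From mathcomp Require Import measurable_realfun zify.

Set Implicit Arguments.
Unset Strict Implicit.
Unset Printing Implicit Defensive.

Import Order.TTheory GRing.Theory Num.Theory.
Import numFieldNormedType.Exports.
Local Open Scope classical_set_scope.
Local Open Scope ring_scope.

(** * Intervals and the scaling of Lebesgue measure *)

Lemma measurable_Ico (R : realType) (a b : R) : measurable (Ico a b).
Proof.
rewrite (_ : Ico a b = `[a, b[%classic); first exact: measurable_itv.
by apply/seteqP; split => x; rewrite /Ico/= in_itv.
Qed.

Lemma measurable_lt (R : realType) (a : R) : measurable [set x | x < a].
Proof.
rewrite (_ : [set x | x < a] = `]-oo, a[%classic); first exact: measurable_itv.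
by apply/seteqP; split => x; rewrite /= in_itv.
Qed.

(** The image of [c^-1] times Lebesgue measure under [x / c] gives every interval []a, b]] its
    length, so it is Lebesgue measure by uniqueness. *)
Lemma lebesgue_measure_scale (R : realType) (c : R) (B : set R) :
  0 < c -> measurable B ->
  lebesgue_measure [set x : R | B (x / c)] = (c%:E * lebesgue_measure B)%E.
Proof.
move=> c0 mB.
have ci0 : 0 <= c^-1 by rewrite invr_ge0 ltW.
pose mu := pushforward (T1 := measurableTypeR R) (T2 := measurableTypeR R)
  (mscale (NngNum ci0) lebesgue_measure) (fun x : R => x / c).
suff -> : lebesgue_measure B = mu B.
  by rewrite /mu /mscale/= muleA -EFinM mulfV ?gt_eqF// mul1e.
apply: (lebesgue_measure_unique _ mB) => [|mdiv X [[a b] _ <-] /=].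
  exact: mulrr_measurable.
rewrite /mu /mscale/= /pushforward/=.
have -> : (fun x : R => x / c) @^-1` `]a, b] = `]a * c, b * c]%classic.
  by apply/seteqP; split => x /=; rewrite !in_itv/= ltr_pdivlMr// ler_pdivrMr.
rewrite !lebesgue_measure_itv /= !lte_fin ltr_pM2r//.
case: ifPn => _; last by rewrite mule0.
by rewrite -!EFinB -EFinM -mulrBl mulrCA mulVf ?gt_eqF// mulr1.
Qed.

(** * A converse Borel-Cantelli lemma through first occurrences *)

(* [seqDU F n] says that [F n] is the first event to occur; from then on the
   expected number of occurrences is at most [t + S], where [S] is a partial
   sum of the [P (F k)].  Hence [S <= P (\bigcup_k F k) * (t + S)]. *)
Lemma first_occurrence_borel_cantelli (R : realType) (d : measure_display)
    (T : measurableType d) (P : probability T R) (F : (set T)^nat) (t : nat) :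
  (forall n, measurable (F n)) ->
  (forall n k, (P (seqDU F n `&` F (k + (n + t))%N) <= P (seqDU F n) * P (F k))%E) ->
  (\sum_(0 <= n <oo) P (F n) = +oo)%E ->
  P (\bigcup_n F n) = 1%E.
Proof.
move=> mF later infS.
have mD := seqDU_measurable mF.
set q := P (\bigcup_n F n).
have q1 : (q <= 1)%E by apply: probability_le1; exact: bigcupT_measurable.
have qfin : q \is a fin_num.
  by apply: fin_num_measure; exact: bigcupT_measurable.
pose S N := (\sum_(0 <= k < N) P (F k))%E.
have S0 N : (0 <= S N)%E by exact: sume_ge0.
have Sfin N : S N \is a fin_num.
  by apply/sum_fin_numP => k _ _; rewrite fin_num_measure.
(* If [F k] occurs, the first occurrence is at some [n <= k]. *)
have firstk k : P (F k) = (\sum_(0 <= n < k.+1) P (seqDU F n `&` F k))%E.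
  have mDF n : measurable (seqDU F n `&` F k) by exact: measurableI.
  have tDF : trivIset setT (fun n => seqDU F n `&` F k).
    by apply: trivIset_setIr; exact: trivIset_seqDU.
  rewrite big_mkord -(measure_bigsetU P mDF tDF).
  congr (P _); rewrite -big_distrl/= -bigsetU_seqDU big_ord_recr/=.
  by apply/esym/setIidr => x Fx; right.
have firstN N k : (k < N)%N ->
    (P (F k) <= \sum_(0 <= n < N) P (seqDU F n `&` F k))%E.
  move=> kN; rewrite firstk [leRHS](big_cat_nat (leq0n k.+1) kN)//= leeDl// sume_ge0//.
(* Terms with [k < n] vanish because [n] is first, the next [t] terms are each at most
   [P (seqDU F n)], and [later] bounds the rest. Extending the range to [N + (n + t)] leaves exactly
   [N] terms after the shift. *)
have after n N : (\sum_(0 <= k < N) P (seqDU F n `&` F k) <=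
    P (seqDU F n) * (t%:R%:E + S N))%E.
  apply: (@le_trans _ _ (\sum_(0 <= k < N + (n + t)) P (seqDU F n `&` F k))%E).
    by rewrite [leRHS](big_cat_nat (leq0n _) (leq_addr (n + t) N))//= leeDl// sume_ge0.
  rewrite (big_cat_nat (n := n))//=; last by rewrite addnCA leq_addr.
  rewrite [X in (X + _)%E]big_nat_cond big1 ?add0e; last first.
    move=> k /andP[/andP[_ kn] _].
    suff -> : seqDU F n `&` F k = set0 by rewrite measure0.
    rewrite -subset0 => x [[_ nF] Fk]; apply: nF.
    by rewrite -bigcup_mkord; exists k.
  rewrite (big_cat_nat (n := (n + t)%N))//=; last 2 first.
  - exact: leq_addr.
  - exact: leq_addl.
  rewrite muleDr ?fin_num_adde_defr ?fin_num_measure//; apply: leeD.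
    apply: (@le_trans _ _ (\sum_(n <= k < n + t) P (seqDU F n))%E).
      by apply: lee_sum => k _; rewrite le_measure// ?inE//; exact: measurableI.
    rewrite -(fineK (fin_num_measure P _ (mD n))) sumEFin sumr_const_nat addKn.
    by rewrite -EFinM mulr_natr.
  rewrite -{1}[(n + t)%N]add0n big_addn addnK /S.
  by rewrite ge0_sume_distrr//; apply: lee_sum => k _; exact: later.
have main N : (S N <= q * (t%:R%:E + S N))%E.
  apply: (@le_trans _ _ (\sum_(0 <= k < N) \sum_(0 <= n < N) P (seqDU F n `&` F k))%E).
    rewrite /S big_nat_cond [leRHS]big_nat_cond; apply: lee_sum => k.
    by move=> /andP[/andP[_ kN] _]; exact: firstN.
  rewrite exchange_big/=.
  apply: (@le_trans _ _ (\sum_(0 <= n < N) P (seqDU F n) * (t%:R%:E + S N))%E).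
    by apply: lee_sum => n _; exact: after.
  rewrite -ge0_sume_distrl//; apply: lee_wpmul2r.
    by rewrite adde_ge0// lee_fin.
  rewrite big_mkord -(measure_bigsetU P mD (@trivIset_seqDU _ F)).
  rewrite le_measure ?inE//; [exact: bigsetU_measurable|exact: bigcupT_measurable|].
  by rewrite -bigsetU_seqDU -bigcup_mkord => x [i _ Fi]; exists i.
(* If [q < 1], then [main] bounds every partial sum by [q t / (1 - q)], against divergence. *)
apply/eqP; rewrite eq_le q1 leNgt; apply/negP => q_lt1.
have qr1 : fine q < 1 by rewrite -lte_fin fineK.
have bnd N : (S N <= (fine q * t%:R / (1 - fine q))%:E)%E.
  have := main N; rewrite -(fineK (Sfin N)) -{1}(fineK qfin) -EFinD -EFinM !lee_fin.
  rewrite ler_pdivlMr ?subr_gt0// => h.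
  by rewrite mulrBr mulr1 lerBlDr (le_trans h)// mulrDr lerD2l mulrC.
suff : ((+oo : \bar R) <= (fine q * t%:R / (1 - fine q))%:E)%E by rewrite leNgt ltry.
rewrite -infS; apply: lime_le; first exact: is_cvg_nneseries.
by apply: nearW => N; exact: bnd.
Qed.

(** * Events determined by finitely many coordinates *)

(** Sequences stay infinite and only the first [N] coordinates are constrained, so one type carries
    the sigma-algebras for all [N]. *)
Definition rectangles (R : realType) (N : nat) : set (set (nat -> R)) :=
  [set [set x | forall i, (i < N)%N -> B i (x i)] |
     B in [set B : nat -> set R | forall i, measurable (B i)]].

Lemma setI_closed_rectangles (R : realType) (N : nat) :
  setI_closed (@rectangles R N).
Proof.
move=> _ _ [B mB <-] [C mC <-]; exists (fun i => B i `&` C i).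
  by move=> i; apply: measurableI; [exact: mB|exact: mC].
by apply/seteqP; split => [x BC|x [Bx Cx] i iN]; [split => i /BC[]|split; auto].
Qed.

Lemma measurable_coordinate (R : realType) (N i : nat) : (i < N)%N ->
  measurable_fun [set: g_sigma_algebraType (@rectangles R N)]
    (fun x : g_sigma_algebraType (@rectangles R N) => x i : R).
Proof.
move=> iN _ B mB; rewrite setTI; apply: sub_sigma_algebra.
exists (fun j => if j == i then B else setT) => [j|].
  by case: ifP => // _; exact: measurableT.
apply/seteqP; split => [x /(_ _ iN)|x /= Bxi j _]; first by rewrite eqxx.
by case: eqP => [->|//].
Qed.

Lemma measurable_rectangle (R : realType) (d : measure_display)
    (T : measurableType d) (N : nat) (X : nat -> T -> R) (B : nat -> set R) :
  (forall i, (i < N)%N -> measurable_fun setT (X i)) ->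
  (forall i, measurable (B i)) ->
  measurable [set t | forall i, (i < N)%N -> B i (X i t)].
Proof.
move=> mX mB.
rewrite (_ : [set t | _] = \bigcap_(i in [set i | (i < N)%N]) (X i @^-1` B i)).
  apply: bigcap_measurableType => i /= iN.
  by rewrite -[X in measurable X]setTI; apply: mX => //; exact: mB.
by apply/seteqP; split.
Qed.

Lemma measurable_trajectory (R : realType) (d : measure_display)
    (T : measurableType d) (N : nat) (X : nat -> T -> R) :
  (forall i, (i < N)%N -> measurable_fun setT (X i)) ->
  forall C, <<s @rectangles R N >> C -> measurable [set t | C (X^~ t)].
Proof.
move=> mX C mC; rewrite -[X in measurable X]setTI.
suff mXt : measurable_fun setT
    (fun t => X^~ t : g_sigma_algebraType (@rectangles R N)).
  exact: (mXt measurableT C mC).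
apply: (@measurability _ _ _ (g_sigma_algebraType (@rectangles R N)) _ _
  (@rectangles R N)) => //.
by move=> _ [_ [B mB <-] <-]; rewrite setTI; exact: measurable_rectangle.
Qed.

(** Dynkin's theorem: rectangles form a pi-system and both sides are countably additive in [C]. When
    [P W > 0], it says that [X] conditioned on [W] has the law of [Y] on the first [N]
    coordinates. *)
Lemma law_unique (R : realType) (d : measure_display) (T : measurableType d)
    (P : probability T R) (N : nat) (X Y : nat -> T -> R) (W : set T) (c : R) :
  (forall i, (i < N)%N -> measurable_fun setT (X i)) ->
  (forall i, (i < N)%N -> measurable_fun setT (Y i)) ->
  measurable W ->
  (forall B : nat -> set R, (forall i, measurable (B i)) ->
    P (W `&` [set t | forall i, (i < N)%N -> B i (X i t)]) =
    (c%:E * P [set t | forall i, (i < N)%N -> B i (Y i t)])%E) ->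
  forall C, <<s @rectangles R N >> C ->
    P (W `&` [set t | C (X^~ t)]) = (c%:E * P [set t | C (Y^~ t)])%E.
Proof.
move=> mX mY mW eqB.
(* The full rectangle forces [c = P W], which the complement step requires. *)
have eqT : P W = c%:E.
  have := eqB (fun=> setT) (fun=> measurableT).
  rewrite (_ : [set t | _] = setT) ?setIT; last by apply/seteqP; split.
  by rewrite probability_setT mule1.
have Pfin A : measurable A -> P A \is a fin_num by exact: fin_num_measure.
apply: (@dynkin_induction _ (g_sigma_algebraType (@rectangles R N))) => //.
- exact: setI_closed_rectangles.
- by rewrite !setIT eqT probability_setT mule1.
- by move=> _ [B mB <-]; exact: eqB.
- move=> S mS eqS; rewrite -[X in W `&` X]/(~` [set t | S (X^~ t)]) -setDE.
  rewrite -[X in (_ * P X)%E]/(~` [set t | S (Y^~ t)]).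
  have mXS := measurable_trajectory mX mS.
  have mYS := measurable_trajectory mY mS.
  rewrite measureD//; last by rewrite -ge0_fin_numE// Pfin.
  rewrite probability_setC// [X in (_ - X)%E]eqS [X in (X - _)%E]eqT muleDr//.
  by rewrite mule1 muleN.
move=> F mF tF eqF.
have disj (Z : nat -> T -> R) : trivIset setT (fun n => [set t | F n (Z^~ t)]).
  apply/trivIsetP => i j _ _ ij; rewrite -subset0 => t [Fi Fj].
  by move/trivIsetP : tF => /(_ i j I I ij); rewrite -subset0 => /(_ (Z^~ t)); apply.
rewrite (_ : [set t | _ (X^~ t)] = \bigcup_n [set t | F n (X^~ t)])//.
rewrite (_ : [set t | _ (Y^~ t)] = \bigcup_n [set t | F n (Y^~ t)])//.
rewrite setI_bigcupr measure_semi_bigcup; last 3 first.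
- by move=> n; apply: measurableI => //; exact: (measurable_trajectory mX (mF _)).
- by apply: trivIset_setIl; exact: disj.
- apply: bigcupT_measurable => n; apply: measurableI => //.
  exact: (measurable_trajectory mX (mF _)).
rewrite measure_semi_bigcup; last 3 first.
- by move=> n; exact: (measurable_trajectory mY (mF _)).
- exact: disj.
- by apply: bigcupT_measurable => n; exact: (measurable_trajectory mY (mF _)).
rewrite -nneseriesZl//.
by apply: eq_eseriesr => n _; exact: eqF.
Qed.

(** * The infima [a_k] and the coupling function below [a_1] *)

Lemma ak_ge0 (R : realType) (G : countType) (p : G -> (nat -> G) -> R)
    (g : G) (s : seq G) :
  (forall g w, 0 <= p g w) -> 0 <= ak p g s.
Proof.
move=> p0; rewrite /ak; set S := (X in inf X).
(* A word that begins no admissible history gives an empty set, whose [inf] is 0. *)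
have [->|/set0P S0] := eqVneq S set0; first by rewrite inf0.
by apply: lb_le_inf => // _ [z _ <-].
Qed.

Lemma ak_le (R : realType) (G : countType) (p : G -> (nat -> G) -> R)
    (g : G) (s : seq G) (z : nat -> G) :
  (forall g w, 0 <= p g w) -> admissible p z -> mkseq z (size s) = s ->
  ak p g s <= p g z.
Proof.
move=> p0 zp zs; apply: ge_inf; last by exists z.
by exists 0 => _ [y _ <-].
Qed.

Lemma akw_ge0 (R : realType) (G : countType) (p : G -> (nat -> G) -> R)
    (k : int) (g : G) (w : nat -> G) :
  (forall g w, 0 <= p g w) -> 0 <= akw p k g w.
Proof. by case: k => n p0 //=; exact: ak_ge0. Qed.

Lemma A_le_aword (R : realType) (G : countType) (p : G -> (nat -> G) -> R)
    (k : nat) (w : nat -> G) :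
  (forall g w, 0 <= p g w) -> admissible p w -> A p k <= aword p k w.
Proof.
move=> p0 wp; apply: ge_inf; last by exists w.
exists 0 => _ [z _ <-]; rewrite /aword fine_ge0// esum_ge0// => g _.
by rewrite lee_fin akw_ge0.
Qed.

(** An initial word of the new history is [g] followed by an initial word of [z]; the latter is not
    forbidden, and [z] itself shows that [p g] does not vanish on all its continuations. *)
Lemma admissible_cons (R : realType) (G : countType) (p : G -> (nat -> G) -> R)
    (g : G) (z : nat -> G) :
  admissible p z -> p g z != 0 ->
  admissible p (fun i => if i is j.+1 then z j else g).
Proof.
move=> zp pgz [//|n].
have -> : mkseq (fun i => if i is j.+1 then z j else g) n.+1 = g :: mkseq z n.
  by rewrite /mkseq/= (iotaDl 1 0) -map_comp.
move=> /= [/zp//|/(_ z)]; rewrite size_mkseq => /(_ erefl)/eqP.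
by rewrite (negPf pgz).
Qed.

(* For [u < a_1] only the intervals [B_0] and [B_1] matter. *)
Lemma ftilde_spec (R : realType) (G : countType) (p : G -> (nat -> G) -> R)
    (f : R -> (nat -> G) -> G) :
  (forall g w, 0 <= p g w) -> max_coupling p f -> 0 < A p 1 <= 1 ->
  forall x, allowed p x -> exists B : G -> set R,
    [/\ forall g, measurable (B g),
        forall g u, 0 <= u < 1 -> ftilde p f u x = g <-> B g u &
        forall g u, B g u -> allowed p g].
Proof.
move=> p0 [c [cov fE]] /andP[a0 a1] x xp.
(* This is the history that [ftilde] itself selects for the letter [x]. *)
pose w := ClassicalEpsilon.epsilon (inhabits (fun _ : nat => x))
  (fun z => admissible p z /\ z 0%N = x).
have [wp _] : admissible p w /\ w 0%N = x
  by exact: (ClassicalEpsilon.epsilon_spec _ _ xp).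
pose I k g := Ico (c k g (mkseq w k)) (c k g (mkseq w k) + bk p k g w).
have sub01 (u : R) : 0 <= u < 1 -> 0 <= A p 1 * u < A p 1.
  by move=> /andP[u0 u1]; rewrite mulr_ge0 ?(ltW a0)//= gtr_pMr.
have lt1 (u : R) : 0 <= u < A p 1 -> 0 <= u < 1.
  by move=> /andP[-> u1]; rewrite (lt_le_trans u1).
(* The [B_0] intervals cover [[0, a_0(w))] and the [B_1] intervals cover [[a_0(w), a_1(w))], where
   [a_1(w) >= A p 1]. *)
have covered (u : R) : 0 <= u < A p 1 -> exists g, I 0%N g u \/ I 1%N g u.
  move=> /andP[u0 uA].
  have [ua|au] := ltP u (aword p 0 w).
    have [_ cov0] := cov w 0%N wp.
    have : Ico (aword p (0%:Z - 1) w) (aword p 0%:Z w) u.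
      rewrite /Ico/= ua andbT (le_trans _ u0)// /aword /=.
      by rewrite esum1.
    by rewrite -cov0 => -[g _ Ig]; exists g; left.
  have [_ cov1] := cov w 1%N wp.
  have : Ico (aword p (1%:Z - 1) w) (aword p 1%:Z w) u.
    by rewrite /Ico/= subrr au/= (lt_le_trans uA)// A_le_aword.
  by rewrite -cov1 => -[g _ Ig]; exists g; right.
exists (fun g => Ico 0 1 `&` ( *%R (A p 1) @^-1` (I 0%N g `|` I 1%N g))).
split.
- move=> g; apply: measurableI; first exact: measurable_Ico.
  rewrite -[X in measurable X]setTI; apply: mulrl_measurable => //.
  by apply: measurableU; exact: measurable_Ico.
- move=> g u u01; split => [fg|[_ Ig]]; last first.
    by case: Ig => Ig; apply: (fE _ _ _ _ wp (lt1 _ (sub01 _ u01)) Ig).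
  split=> //; have [g' Ig'] := covered _ (sub01 _ u01).
  suff <- : g' = g by [].
  rewrite -fg; apply/esym.
  by case: Ig' => Ig; apply: (fE _ _ _ _ wp (lt1 _ (sub01 _ u01)) Ig).
move=> g u [u01 Ig].
(* A nonempty interval has [b_k > 0], hence [p g w >= a_k(g|w) > 0], and [g] can be put in front of
   [w]. *)
suff pgw : 0 < p g w by exists (fun i => if i is j.+1 then w j else g);
  split => //; apply: admissible_cons => //; rewrite gt_eqF.
have IP k : I k g (A p 1 * u) -> 0 < bk p k g w.
  by move=> /andP[h1 h2]; rewrite -(ltrDl (c k g (mkseq w k))) (le_lt_trans h1 h2).
case: Ig => /IP; rewrite /bk subr_gt0 => h.
- by apply: (lt_le_trans h); apply: ak_le.
- apply: (le_lt_trans (akw_ge0 _ _ _ p0)); apply: (lt_le_trans h).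
  by apply: ak_le => //; rewrite size_mkseq.
Qed.

Lemma allowed_ftilde_iter (R : realType) (G : countType)
    (p : G -> (nat -> G) -> R) (f : R -> (nat -> G) -> G) :
  (forall g w, 0 <= p g w) -> max_coupling p f -> 0 < A p 1 <= 1 ->
  forall (us : seq R) x, (forall u, u \in us -> 0 <= u < 1) -> allowed p x ->
  allowed p (ftilde_iter p f us x).
Proof.
move=> p0 fmax A1 us x; elim: us => //= u us IH us01 xp.
have yp : allowed p (ftilde_iter p f us x).
  by apply: IH => // v vus; apply: us01; rewrite inE vus orbT.
have [B [_ BE Bp]] := ftilde_spec p0 fmax A1 yp.
by apply: (Bp _ u); apply/BE => //; apply: us01; rewrite inE eqxx.
Qed.

(** * Measurability of the coalescence events [E] *)

Lemma countable_bigcap_measurable (d : measure_display) (T : measurableType d)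
    (I : countType) (F : I -> set T) :
  (forall i, measurable (F i)) -> measurable (\bigcap_i F i).
Proof.
move=> mF; rewrite -[X in measurable X]setCK setC_bigcap.
apply: measurableC; apply: countable_bigcupT_measurable => //.
by move=> i; apply: measurableC.
Qed.

Lemma measurable_prop (d : measure_display) (T : measurableType d) (Q : Prop) :
  measurable [set _ : T | Q].
Proof.
have [q|nq] := pselect Q.
  by rewrite (_ : [set _ | _] = setT) //; apply/seteqP; split.
by rewrite (_ : [set _ | _] = set0) //; apply/seteqP; split.
Qed.

Section MeasurabilityE.
Context (R : realType) (G : countType) (p : G -> (nat -> G) -> R)
  (f : R -> (nat -> G) -> G).
Context (p0 : forall g w, 0 <= p g w) (fmax : max_coupling p f)
  (A1 : 0 < A p 1 <= 1) (d : measure_display) (T : measurableType d) (Y : nat -> T -> R).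

(** A maximal coupling function is constrained only for arguments in [[0, 1)], so measurability is
    claimed only on this set. *)
Let inrange (r : seq nat) : set T := [set t | forall i, i \in r -> 0 <= Y i t < 1].

(** Induction on the list: split over the countably many letters [y] reached before the last step,
    which then succeeds exactly when the last variable lies in the Borel set given by [ftilde_spec]
    at [y]. *)
Lemma measurable_ftilde_iter (r : seq nat) x g :
  (forall i, i \in r -> measurable_fun setT (Y i)) -> allowed p x ->
  measurable (inrange r `&` [set t | ftilde_iter p f [seq Y i t | i <- r] x = g]).
Proof.
move=> mY xp; elim: r g mY => [|i r IH] g mY.
  rewrite /=; apply: measurableI; last exact: measurable_prop.
  by rewrite (_ : inrange _ = setT) ?predeqE.
have [Bf BfP] : {Bf : G -> G -> set R & forall y, allowed p y ->
    [/\ forall g, measurable (Bf y g),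
        forall g u, 0 <= u < 1 -> ftilde p f u y = g <-> Bf y g u &
        forall g u, Bf y g u -> allowed p g]}.
  suff /choice[Bf BfP] : forall y, exists B : G -> set R, allowed p y ->
    [/\ forall g, measurable (B g),
        forall g u, 0 <= u < 1 -> ftilde p f u y = g <-> B g u &
        forall g u, B g u -> allowed p g] by exists Bf.
  move=> y; have [yp|nyp] := pselect (allowed p y); last by exists (fun _ => set0).
  by have [B BP] := ftilde_spec p0 fmax A1 yp; exists B.
have mYi : measurable_fun setT (Y i) by apply: mY; rewrite inE eqxx.
have mYr j : j \in r -> measurable_fun setT (Y j).
  by move=> jr; apply: mY; rewrite inE jr orbT.
rewrite (_ : _ `&` _ = (Y i @^-1` Ico 0 1) `&`
   \bigcup_y ([set _ : T | allowed p y] `&` (Y i @^-1` Bf y g) `&`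
     (inrange r `&` [set t | ftilde_iter p f [seq Y j t | j <- r] x = y]))).
  apply: measurableI.
    by rewrite -[X in measurable X]setTI; apply: mYi => //; exact: measurable_Ico.
  apply: countable_bigcupT_measurable => // y.
  apply: measurableI; last exact: IH.
  have [yp|nyp] := pselect (allowed p y); last first.
    by rewrite (_ : _ `&` _ = set0)// -subset0 => t [].
  apply: measurableI; first exact: measurable_prop.
  rewrite -[X in measurable X]setTI; apply: mYi => //.
  by have [+ _ _] := BfP _ yp; apply.
apply/seteqP; split=> t /=.
  move=> [rng fg].
  have r01 j : j \in r -> 0 <= Y j t < 1 by move=> jr; apply: rng; rewrite inE jr orbT.
  have i01 : 0 <= Y i t < 1 by apply: rng; rewrite inE eqxx.
  split=> //.
  exists (ftilde_iter p f [seq Y j t | j <- r] x) => //=.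
  have yp : allowed p (ftilde_iter p f [seq Y j t | j <- r] x).
    by apply: allowed_ftilde_iter => // u /mapP[j jr ->]; exact: r01.
  by split=> //; split=> //; have [_ BE _] := BfP _ yp; apply/(BE _ _ i01).
move=> -[i01 [y _ [[yp Byg] [r01 fy]]]]; split.
  by move=> j; rewrite inE => /orP[/eqP ->//|/r01].
by rewrite fy; have [_ BE _] := BfP _ yp; apply/(BE _ _ i01).
Qed.

(** Coalescence is a countable intersection over pairs of allowed starting letters of a countable
    union over the common value [g]. *)
Lemma measurable_E (r : seq nat) n :
  (forall i, i \in r -> measurable_fun setT (Y i)) ->
  measurable [set t | E p f n [seq Y i t | i <- r]].
Proof.
move=> mY.
rewrite (_ : [set t | _] = [set _ : T | size r = n] `&` (
  (\bigcap_(i in [set i | i \in r]) (Y i @^-1` Ico 0 1)) `&`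
  \bigcap_(w : G) \bigcap_(w' : G) ([set _ : T | ~ (allowed p w /\ allowed p w')] `|`
    [set _ : T | allowed p w /\ allowed p w'] `&` \bigcup_g (
     (inrange r `&` [set t | ftilde_iter p f [seq Y i t | i <- r] w = g]) `&`
     (inrange r `&` [set t | ftilde_iter p f [seq Y i t | i <- r] w' = g]))))).
  apply: measurableI; first exact: measurable_prop.
  apply: measurableI.
    apply: bigcap_measurableType => i /= ir.
    by rewrite -[X in measurable X]setTI; apply: mY => //; exact: measurable_Ico.
  apply: countable_bigcap_measurable => w; apply: countable_bigcap_measurable => w'.
  apply: measurableU; first exact: measurable_prop.
  have [[wp w'p]|nw] := pselect (allowed p w /\ allowed p w'); last first.
    by rewrite (_ : _ `&` _ = set0)// -subset0 => t [].
  apply: measurableI; first exact: measurable_prop.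
  apply: countable_bigcupT_measurable => // g.
  by apply: measurableI; exact: measurable_ftilde_iter.
rewrite /E; apply/seteqP; split=> t /=.
  move=> [sz [rng agree]]; rewrite size_map in sz; split=> //.
  have r01 i : i \in r -> 0 <= Y i t < 1 by move=> ir; apply: rng; exact: map_f.
  split; first by move=> i /= ir; exact: r01.
  move=> w _ w' _.
  have [[wp w'p]|nw] := pselect (allowed p w /\ allowed p w'); last by left.
  right; split=> //; exists (ftilde_iter p f [seq Y i t | i <- r] w) => //=.
  by split; split=> //; exact: agree.
move=> [sz [rng agree]]; rewrite size_map; split=> //; split.
  by move=> u /mapP[i ir ->]; exact: rng.
move=> w w' wp w'p; have [[]//|[_ [g _ [[_ <-] [_ <-]]]]//] := agree w I w' I.
Qed.

End MeasurabilityE.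

(** * Blocks of independent uniform variables *)

Section Blocks.
Context (R : realType) (d : measure_display) (Omega : measurableType d)
  (P : probability Omega R) (U : int -> Omega -> R)
  (iidU : iid_uniform01 P U).

(** The left inverse [g] makes the indices distinct and turns the sets into a family over the
    integers, as the independence hypothesis asks. *)
Lemma iid_rectangle (h : nat -> int) (g : int -> nat) (N : nat)
    (B : nat -> set R) :
  cancel h g -> (forall i, measurable (B i)) ->
  P [set om | forall i, (i < N)%N -> B i (U (h i) om)] =
  (\prod_(0 <= i < N) lebesgue_measure (B i `&` Ico 0 1))%E.
Proof.
move=> hK mB; have [_ [law indep]] := iidU.
pose S := [seq h i | i <- iota 0 N].
have uS : uniq S by rewrite map_inj_uniq ?iota_uniq//; exact: can_inj hK.
have mBg i : measurable (B (g i)) by [].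
have := indep S (B \o g) uS mBg.
rewrite (_ : \bigcap_(i in _) _ =
  [set om | forall i, (i < N)%N -> B i (U (h i) om)]); last first.
  apply/seteqP; split=> om Bom i.
    move=> iN; have /= := Bom (h i); rewrite hK; apply.
    by apply: map_f; rewrite mem_iota.
  by move=> /mapP[j]; rewrite mem_iota /= add0n => jN -> /=; rewrite hK; exact: Bom.
move=> ->; rewrite big_map /index_iota subn0.
by apply: eq_bigr => i _; rewrite law//= hK.
Qed.

Local Notation V i := (U (- (Posz i))).

Let VK : cancel (fun i : nat => - i%:Z) (fun z : int => absz z).
Proof. by move=> i; rewrite abszN. Qed.

Let mU i : measurable_fun setT (U i).
Proof. by have [+ _] := iidU; apply. Qed.

Let V_rectangle (N : nat) (B : nat -> set R) :
  (forall i, measurable (B i)) ->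
  P [set om | forall i, (i < N)%N -> B i (V i om)] =
  (\prod_(0 <= i < N) lebesgue_measure (B i `&` Ico 0 1))%E.
Proof. by move=> mB; rewrite -(iid_rectangle _ VK). Qed.

(* Conditionally on being smaller than [a], a variable uniform on [0, 1) divided
   by [a] is again uniform on [0, 1). *)
Lemma scaled_block (N s : nat) (a : R) (B : nat -> set R) (C : set (nat -> R)) :
  0 < a <= 1 -> (forall i, measurable (B i)) -> <<s @rectangles R s >> C ->
  (forall x, C x -> forall i, (i < s)%N -> 0 <= x i < 1) ->
  P [set om | (forall i, (i < N)%N -> B i (V i om)) /\
              C (fun i => V (N + i)%N om / a)] =
  (P [set om | forall i, (i < N)%N -> B i (V i om)] *
   ((a ^+ s)%:E * P [set om | C (fun i => U (s%:Z - 1 - i%:Z)%R om)]))%E.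
Proof.
move=> /andP[a0 a1] mB mC C01.
pose W := [set om | (forall i, (i < N)%N -> B i (V i om)) /\
                    forall i, (i < s)%N -> Ico 0 1 (V (N + i)%N om / a)].
pose X i om := V (N + i)%N om / a.
pose Y i om := U (s%:Z - 1 - i%:Z)%R om.
have mX i : measurable_fun setT (X i).
  by apply: measurable_funM => //; exact: mU.
have mY i : measurable_fun setT (Y i) by exact: mU.
have mrect : measurable [set om | forall i, (i < N)%N -> B i (V i om)].
  exact: (measurable_rectangle (X := fun i => V i)).
have mW : measurable W.
  apply: measurableI => //.
  apply: (measurable_rectangle (X := X) (B := fun=> Ico 0 1)) => // i.
  exact: measurable_Ico.
set r := P [set om | forall i, (i < N)%N -> B i (V i om)].
have rfin : r \is a fin_num by exact: fin_num_measure.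
rewrite muleA -(fineK rfin) -EFinM -/(Y _ _).
(* Given [W], the scaled variables should have the law of [Y]; since [C] already implies the range
   condition, [W] absorbs it. *)
rewrite -(@law_unique _ _ _ P s X Y W) //.
  congr (P _); apply/seteqP; split=> om [].
    by move=> h1 h2; do 2 split=> //; exact: C01.
  by move=> [h1 _] h2; split.
move=> B' mB'.
pose B2 i := if (i < N)%N then B i
  else [set x | (B' (i - N)%N `&` Ico 0 1) (x / a)].
have mI j : measurable [set x : R | (B' j `&` Ico 0 1) (x / a)].
  have mdiv : measurable_fun [set: R] (fun x : R => x / a).
    exact: mulrr_measurable.
  rewrite -[X in measurable X]setTI; apply: mdiv => //.
  by apply: measurableI => //; exact: measurable_Ico.
have mB2 i : measurable (B2 i) by rewrite /B2; case: ifP.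
rewrite (_ : _ `&` _ = [set om | forall i, (i < N + s)%N -> B2 i (V i om)]); last first.
  apply/seteqP; split=> om /=.
    move=> [[h1 h2] h3] i iNs; rewrite /B2; case: ifPn => [|]; first exact: h1.
    rewrite -leqNgt => Ni.
    have isN : (i - N < s)%N by rewrite ltn_subLR.
    split; first by have := h3 _ isN; rewrite /X subnKC.
    by have := h2 _ isN; rewrite subnKC.
  move=> h; split; first split.
  - by move=> i iN; have := h i (ltn_addr _ iN); rewrite /B2 iN.
  - move=> i js; have := h (N + i)%N; rewrite ltn_add2l => /(_ js).
    by rewrite /B2 ltnNge leq_addr /= addKn => -[].
  - move=> i js; have := h (N + i)%N; rewrite ltn_add2l => /(_ js).
    by rewrite /B2 ltnNge leq_addr /= addKn => -[].
have YK : cancel (fun i : nat => s%:Z - 1 - i%:Z) (fun z => absz (s%:Z - 1 - z)%R).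
  by move=> i; rewrite opprB addrCA subrr addr0.
rewrite (V_rectangle _ mB2) (iid_rectangle _ YK mB') EFinM (fineK rfin).
rewrite /r (V_rectangle _ mB) (big_cat_nat (leq0n N) (leq_addr s N))/=.
rewrite -muleA; congr (_ * _)%E.
  apply: eq_big_nat => i /andP[_ iN].
  by rewrite /B2 iN.
rewrite -{1}[N]add0n (addnC N s) big_addn addnK.
(* Each scaled factor contributes [a]. As [a <= 1], [x / a] in [[0, 1)] already puts [x] in
   [[0, 1)]. *)
transitivity (\prod_(0 <= i < s) (a%:E * lebesgue_measure (B' i `&` Ico 0 1)))%E.
  apply: eq_bigr => i _; rewrite /B2 ltnNge leq_addl /= addnK.
  rewrite -lebesgue_measure_scale//; last first.
    by apply: measurableI => //; exact: measurable_Ico.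
  congr lebesgue_measure; apply/seteqP; split=> x //=; first by case.
  move=> [Bx /andP[x0 x1]]; split; first by split=> //; apply/andP.
  move: x0 x1; rewrite /Ico/= ler_pdivlMr// mul0r ltr_pdivrMr// mul1r => -> /=.
  by move=> xa; rewrite (lt_le_trans xa).
rewrite big_split/=; congr (_ * _)%E.
elim: s {C mC C01 W X Y mX mY mW mB' B2 mB2 YK mI} => [|s IH]; first by rewrite big_nil.
by rewrite big_nat_recr//= IH exprSr EFinM.
Qed.

End Blocks.

(** * Regeneration events: probability, independence, occurrence *)

Section RegenerationEvents.
Context (R : realType) (G : countType) (p : G -> (nat -> G) -> R)
  (f : R -> (nat -> G) -> G) (p0 : forall g w, 0 <= p g w)
  (fmax : max_coupling p f) (A1 : 0 < A p 1 <= 1)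
  (A01 : forall k, 0 <= A p k.+1 <= 1)
  (d : measure_display) (Omega : measurableType d) (P : probability Omega R)
  (U : int -> Omega -> R) (iidU : iid_uniform01 P U) (s : nat).

Local Notation V i := (U (- (Posz i))).

(* With [x i = U_{-i}]: the coupling started at time [-(N + m)] uses only the
   past up to that time during [-(N + m) < j <= -N], and [E_s] holds for the
   [s] variables ending at time [-(N + m)]. *)
Definition regeneration (N m : nat) : set (nat -> R) :=
  [set x | (forall i, (i < m)%N -> x (N + i)%N < A p (m - i)) /\
           E p f s [seq x (N + m + i)%N / A p 1 | i <- iota 0 s]].

(** The source [Y] is arbitrary so as to cover both the variables on [Omega] and the coordinate maps
    on the sigma-algebra of the first [M] coordinates. *)
Lemma measurable_regeneration (d' : measure_display) (T : measurableType d')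
    (Y : nat -> T -> R) (M N m : nat) :
  (forall i, (i < M)%N -> measurable_fun setT (Y i)) -> (N + m + s <= M)%N ->
  measurable [set t | regeneration N m (Y^~ t)].
Proof.
move=> mY NmsM; apply: measurableI.
  apply: (measurable_rectangle (X := fun i => Y (N + i)%N)
      (B := fun i => [set u | u < A p (m - i)])) => i.
    move=> im; apply: mY; apply: leq_trans NmsM.
    by rewrite -addnA ltn_add2l ltn_addr.
  exact: measurable_lt.
apply: (measurable_E p0 fmax A1 (Y := fun i t => Y (N + m + i)%N t / A p 1)) => i.
rewrite mem_iota /= add0n => ims; apply: measurable_funM => //; apply: mY.
by apply: leq_trans NmsM; rewrite ltn_add2l.
Qed.

Let mU i : measurable_fun setT (U i).
Proof. by have [+ _] := iidU; apply. Qed.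

Local Notation u_ m := (\prod_(1 <= k < m.+1) A p k).

(** The probability that [s] given variables, divided by [a_1], land in [E_s]. *)
Local Notation delta := ((A p 1 ^+ s)%:E *
  P [set om | E p f s [seq U (s%:Z - 1 - i%:Z)%R om | i <- iota 0 s]])%E.

(** The bounds extend the rectangle to [N + m] variables, and [E_s] bears on the next [s] scaled
    ones, so [scaled_block] applies. *)
Lemma regeneration_block (N m : nat) (B : nat -> set R) :
  (forall i, measurable (B i)) ->
  P ([set om | regeneration N m (fun i => V i om)] `&`
     [set om | forall i, (i < N)%N -> B i (V i om)]) =
  (P [set om | forall i, (i < N)%N -> B i (V i om)] * ((u_ m)%:E * delta))%E.
Proof.
move=> mB.
pose B2 i := if (i < N)%N then B i else [set x | x < A p (m - (i - N))].
have mB2 i : measurable (B2 i).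
  by rewrite /B2; case: ifP => // _; exact: measurable_lt.
rewrite muleA.
have -> : (P [set om | forall i, (i < N)%N -> B i (V i om)] * (u_ m)%:E =
    P [set om | forall i, (i < N + m)%N -> B2 i (V i om)])%E.
  pose VK : cancel (fun i : nat => - i%:Z) (fun z : int => absz z) := fun i => abszN i.
  rewrite !(iid_rectangle iidU _ VK)// (big_cat_nat (leq0n N) (leq_addr m N))/=.
  congr (_ * _)%E.
    apply: eq_big_nat => i /andP[_ iN].
    by rewrite /B2 iN.
  (* The bounds come in the order [a_m, ..., a_1], so the product is reversed. *)
  rewrite -{1}[N]add0n (addnC N m) [RHS]big_addn addnK [RHS]big_nat_rev/= add0n.
  rewrite big_add1/= -prodEFin; apply: eq_big_nat => i /andP[_ im].
  rewrite /B2 ltnNge leq_addl /= addnK subKn//.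
  have /andP[Ai0 Ai1] := A01 i.
  rewrite (_ : _ `&` _ = `[0, A p i.+1[%classic).
    by rewrite lebesgue_measure_itv/= lte_fin oppr0 adde0; case: ltgtP Ai0 => // <-.
  apply/seteqP; split => x /=; rewrite in_itv /Ico/=.
    by move=> [-> /andP[->]].
  by move=> /andP[-> xA]; split=> //; exact: lt_le_trans xA Ai1.
rewrite -(@scaled_block _ _ _ P U iidU (N + m) s (A p 1) B2
  [set x | E p f s [seq x i | i <- iota 0 s]])//.
- congr (P _); apply/seteqP; split=> om /=.
    move=> [[h1 h2] h3]; split=> // i iNm; rewrite /B2; case: ifPn => [/h3//|].
    rewrite -leqNgt => Ni /=.
    by have := h1 (i - N)%N; rewrite ltn_subLR// subnKC//; apply.
  move=> [h1 h2]; split; first split=> //.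
    move=> i im; have := h1 (N + i)%N; rewrite ltn_add2l => /(_ im).
    by rewrite /B2 ltnNge leq_addr /= addKn.
  by move=> i iN; have := h1 i (ltn_addr _ iN); rewrite /B2 iN.
- apply: (measurable_E p0 fmax A1
    (T := g_sigma_algebraType (@rectangles R s)) (Y := fun i x => x i)) => i.
  by rewrite mem_iota add0n /= => is_; exact: measurable_coordinate.
- move=> x [_ [x01 _]] i is_; apply: x01; apply: map_f.
  by rewrite mem_iota add0n.
Qed.

(** The value is free of [N]: this is the stationarity used to compare a shifted event with the
    original. *)
Lemma prob_regeneration (N m : nat) :
  P [set om | regeneration N m (fun i => V i om)] = ((u_ m)%:E * delta)%E.
Proof.
have := @regeneration_block N m (fun=> setT) (fun=> measurableT).
by rewrite (_ : [set om | forall i, _] = setT) ?setIT ?probability_setT ?mul1e//;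
  apply/seteqP; split.
Qed.

(** [law_unique] with [X = Y] and the regeneration event as [W] passes from rectangles to all events
    of the first [N] variables. *)
Lemma regeneration_indep (N m : nat) (C : set (nat -> R)) :
  <<s @rectangles R N >> C ->
  P ([set om | regeneration N m (fun i => V i om)] `&`
     [set om | C (fun i => V i om)]) =
  (P [set om | regeneration N m (fun i => V i om)] *
   P [set om | C (fun i => V i om)])%E.
Proof.
have mreg : measurable [set om | regeneration N m (fun i => V i om)].
  exact: (measurable_regeneration (Y := fun i => V i) (M := N + m + s)).
have regfin := fin_num_measure P _ mreg.
move=> mC; rewrite -(fineK regfin).
apply: (@law_unique _ _ _ P N (fun i => V i) (fun i => V i)) => // B mB.
by rewrite regeneration_block// -(prob_regeneration N m) fineK// muleC.
Qed.

Lemma regeneration_occurs : (0 < delta)%E ->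
  (\sum_(1 <= n <oo) (u_ n)%:E = +oo)%E ->
  P (\bigcup_k [set om | regeneration 0 k.+1 (fun i => V i om)]) = 1%E.
Proof.
move=> delta0 infu.
have mreg N m : measurable [set om | regeneration N m (fun i => V i om)].
  exact: (measurable_regeneration (Y := fun i => V i) (M := N + m + s)).
(* The [n]-th event has [m = n.+1] and reads [n.+1 + s] variables, so the gap is [s.+1]. *)
apply: (@first_occurrence_borel_cantelli _ _ _ P _ s.+1) => //.
- move=> n k; pose M := (n.+1 + s)%N.
  pose C := seqDU (fun k => regeneration 0 k.+1) n.
  (* Stated for any [T], to match first occurrences on [Omega] with those on sequences. *)
  have first_occurrenceE T (H : (set T)^nat) :
      seqDU H n = H n `\` \bigcup_(j in `I_n) H j.
    by rewrite /seqDU bigcup_mkord.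
  have -> : seqDU (fun k => [set om | regeneration 0 k.+1 (fun i => V i om)]) n =
      [set om | C (fun i => V i om)].
    by rewrite /C !first_occurrenceE.
  have mC : <<s @rectangles R M >> C.
    have mregM j : (j <= n)%N -> <<s @rectangles R M >> (regeneration 0 j.+1).
      move=> jn; apply: (@measurable_regeneration _
        (g_sigma_algebraType (@rectangles R M)) (fun i x => x i) M).
        by move=> i iM; exact: measurable_coordinate.
      by rewrite add0n leq_add2r.
    rewrite /C first_occurrenceE.
    apply: (@measurableD _ (g_sigma_algebraType (@rectangles R M))).
      exact: mregM.
    apply: (@bigcup_measurable _ (g_sigma_algebraType (@rectangles R M))).
    by move=> j /= jn; apply: mregM; exact: ltnW.
  (* Dropping the bounds on the first [M] variables leaves the event [k.+1] shifted by [M]. *)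
  apply: (@le_trans _ _ (P ([set om | regeneration M k.+1 (fun i => V i om)] `&`
      [set om | C (fun i => V i om)]))).
    rewrite le_measure ?inE//.
    + apply: measurableI => //.
      by apply: (measurable_trajectory (X := fun i => V i) _ mC) => i _.
    + apply: measurableI => //.
      by apply: (measurable_trajectory (X := fun i => V i) _ mC) => i _.
    have kM : (k + (n + s.+1)).+1 = (M + k.+1)%N.
      by rewrite /M addnC !addSn !addnS.
    move=> om [Com [h1 h2]]; split=> //; split.
      move=> i ik; have := h1 (M + i)%N; rewrite add0n kM subnDl ltn_add2l.
      exact.
    by move: h2; rewrite add0n kM.
  rewrite regeneration_indep// muleC le_eqVlt !prob_regeneration eqxx//.
rewrite (eq_eseriesr (g := fun n => (u_ (n + 1))%:E * delta)%E); last first.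
  by move=> n _; rewrite prob_regeneration addn1.
have u0 n : 0 <= u_ n.
  rewrite big_add1; apply: prodr_ge0 => k _.
  by have /andP[] := A01 k.
have dfin : delta \is a fin_num.
  apply: fin_numM => //; apply: fin_num_measure.
  exact: (measurable_E p0 fmax A1 (Y := fun i => U (s%:Z - 1 - i%:Z)%R)).
rewrite -(fineK dfin).
under eq_eseriesr do rewrite muleC.
rewrite nneseriesZl//; last by move=> n _; rewrite lee_fin.
rewrite (nneseries_addn (f := fun n => (u_ n)%:E) 1)//.
by rewrite infu fineK// gt0_muley.
Qed.

End RegenerationEvents.

(** * Finiteness of [tau_0] from one regeneration *)

Theorem theorem2 (R : realType) (G : countType) (p : G -> (nat -> G) -> R)
  (p_ge0 : forall g w, 0 <= p g w)
  (p_sum1 : forall w, \esum_(g in [set: G]) (p g w)%:E = 1%E)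
  (p_meas : kernel_measurable p)
  (f : R -> (nat -> G) -> G) (f_max : max_coupling p f)
  (a1_gt0 : 0 < A p 1)
  (a_incr : {homo A p : n m / (n <= m)%N >-> n <= m})
  (a_cvg1 : A p n @[n --> \oo] --> (1 : R))
  (d : measure_display) (Omega : measurableType d) (P : probability Omega R)
  (U : int -> Omega -> R) (U_iid : iid_uniform01 P U)
  (cond_i : (\sum_(1 <= n <oo) (\prod_(1 <= m < n.+1) A p m)%:E)%E = +oo%E)
  (cond_ii : exists s : nat, (0 < s)%N /\
     (0 < P [set om | E p f s [seq U (s%:Z - 1 - i%:Z)%R om | i <- iota 0 s]])%E) :
  {ae P, forall om, tau0 p f U om \is a fin_num}.
Proof.
have A1_le n : A p n <= 1.
  rewrite -(cvg_lim _ a_cvg1)//; apply: limr_ge.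
    by apply/cvg_ex; exists 1.
  by exists n => // m /= nm; exact: a_incr.
have A1 : 0 < A p 1 <= 1 by rewrite a1_gt0 A1_le.
have A01 k : 0 <= A p k.+1 <= 1.
  by rewrite A1_le andbT (le_trans (ltW a1_gt0))// a_incr.
have [s [s0 posE]] := cond_ii.
have delta0 : (0 < (A p 1 ^+ s)%:E *
    P [set om | E p f s [seq U (s%:Z - 1 - i%:Z)%R om | i <- iota 0 s]])%E.
  by rewrite mule_gt0// lte_fin exprn_gt0.
have occ := regeneration_occurs p_ge0 f_max A1 A01 U_iid delta0 cond_i.
set F := \bigcup_k _ in occ.
have mF : measurable F.
  apply: bigcupT_measurable => k.
  apply: (measurable_regeneration p_ge0 f_max A1 (s := s)
    (Y := fun i => U (- i%:Z)) (M := 0 + k.+1 + s)) => // i _.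
  by have [+ _] := U_iid; apply.
exists (~` F); split; [exact: measurableC| |].
  by rewrite probability_setC// occ subee.
move=> om; apply: contra_not => -[k _ [Kom Eom]].
(* The [s] variables of the [E_s] block occupy the times from [m] to [l]. *)
pose l : int := - (k.+1)%:Z; pose m : int := l - (s.-1)%:Z.
have m_tau : tau0_set p f U om m.
  split; first by rewrite /m /l; lia.
  exists l; split; first by rewrite /m /l; lia.
  have -> : (absz (l - m)).+1 = s by rewrite /m /l; lia.
  split.
    move: Eom; rewrite add0n; congr E; apply: eq_map => i.
    by congr (U _ om / _); rewrite /l; lia.
  (* The regeneration bound at time [j] is [U_j < a_{j-l}], so [j - l] itself witnesses
     [K(U_j) <= j - l]. *)
  move=> _ j /andP[lj j0]; exists (absz (j - l)); split; first by lia.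
  have := Kom (absz j); rewrite add0n.
  have -> : (k.+1 - absz j)%N = absz (j - l) by rewrite /l; lia.
  have -> : - (absz j)%:Z = j by lia.
  by apply; rewrite /l in lj; lia.
(* The supremum is at least [m], and at most 0 because all members are negative. *)
rewrite /= /tau0 fin_numElt; apply/andP; split.
  apply: (@lt_le_trans _ _ (m%:~R)%:E); first by rewrite ltNyr.
  by apply: ereal_sup_ubound; exists m.
apply: (@le_lt_trans _ _ 0%E); last by rewrite ltry.
by apply: ge_ereal_sup => _ [j [j0 _] <-]; rewrite lee_fin lerz0 ltW.
Qed.
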